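(* Let $d\geq 1$ be an integer. There exists a constant $C>0$ (depending only on $d$) such that for every $x_0\in\mathbb{Z}^d$, every real $R\geq 1$, and every function $h:\overline{B(x_0,R)}\to[0,\infty)$ that is harmonic in $B(x_0,R)$, $$\max_{y\in B(x_0,R/2)}h(y)\;\leq\; C\min_{z\in B(x_0,R/2)}h(z).$$
   Context: $\mathbb{Z}^d$ is equipped with the graph distance $d(x,y)=\sum_{i=1}^d|x_i-y_i|$ (the symbol $d$ is used both for the dimension and for the distance function), and $x\sim y$ means $d(x,y)=1$. For real $r>0$ and $x_0\in\mathbb{Z}^d$, $B(x_0,r)=\{x\in\mathbb{Z}^d: d(x,x_0)\leq r\}$. For $A\subset\mathbb{Z}^d$, the boundary is $\partial A=\{y\in A^c:\exists\,x\in A\text{ with }x\sim y\}$ and $\overline{A}=A\cup\partial A$. For $f:\overline{A}\to\mathbb{R}$, the Laplacian is $\Delta f(x)=\frac{1}{2d}\sum_{y\sim x}(f(x)-f(y))$ for $x\in A$; $f$ is harmonic in $A$ if $\Delta f(x)=0$ for all $x\in A$. *)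

(* Defs.v *)
From mathcomp Require Export all_boot all_order all_algebra.
From mathcomp Require Export all_classical reals.
Set Implicit Arguments.
Unset Strict Implicit.
Unset Printing Implicit Defensive.
Import Order.TTheory GRing.Theory Num.Theory.
Local Open Scope classical_set_scope.
Local Open Scope ring_scope.

Definition graph_dist (d : nat) (x y : 'rV[int]_d) : nat :=
  (\sum_(i < d) `|(x 0 i - y 0 i)%R|)%N.

Definition adj (d : nat) (x y : 'rV[int]_d) : Prop := graph_dist x y = 1%N.

Definition lattice_ball (R : realType) (d : nat) (x0 : 'rV[int]_d) (r : R) :
    set 'rV[int]_d :=
  [set x | (graph_dist x x0)%:R <= r].

Definition boundary (d : nat) (A : set 'rV[int]_d) : set 'rV[int]_d :=
  [set y | ~ A y /\ exists2 x, A x & adj x y].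

Definition lattice_closure (d : nat) (A : set 'rV[int]_d) : set 'rV[int]_d :=
  A `|` boundary A.

(* A function on [lattice_closure A] is represented by a total function whose
   values off [lattice_closure A] are irrelevant: for [x] in [A], every
   neighbour of [x] lies in [lattice_closure A].
   The sum is over a finite set, so the finite-support convention of fsbigop
   plays no role. *)
Definition laplacian (R : realType) (d : nat) (f : 'rV[int]_d -> R)
    (x : 'rV[int]_d) : R :=
  (2 * d%:R)^-1 * \sum_(y \in [set y | adj y x]) (f x - f y).

Definition harmonic_in (R : realType) (d : nat) (A : set 'rV[int]_d)
    (f : 'rV[int]_d -> R) : Prop :=
  forall x, A x -> laplacian f x = 0.

Definition is_max (R : realType) (S : set R) (M : R) : Prop :=
  S M /\ ubound S M.

Definition is_min (R : realType) (S : set R) (m : R) : Prop :=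
  S m /\ lbound S m.

(* Main.v *)
Require Import Defs.
From mathcomp Require Import finmap ring lra zify.
Set Implicit Arguments.
Unset Strict Implicit.
Unset Printing Implicit Defensive.
Import Order.TTheory GRing.Theory Num.Theory.
Local Open Scope classical_set_scope.
Local Open Scope ring_scope.

(* A function h on Z^d is lifted to Z^D with D = 2s + 2, s = d, by letting it be
   constant in the new coordinates; there |x|^(-2s) is the fundamental solution
   of the continuous Laplacian.  The discretisation error of the Laplacian of
   |x|^(-2s) is O(|x|^(-2s-4)), so it is absorbed by a constant shift:
   (|x|^2 + a)^(-s) is superharmonic and (|x|^2 - b)^(-s) is subharmonic away
   from 0.  Subtracting suitable affine functions of |x|^2 and truncating gives
   finitely supported ua and ub with
     Lap ua <= C M^(-s-1) - c [x = 0]    (support |x|^2 <= M),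
     Lap ub >= D P^(-s-1) for B <= |x|^2 <= P, Lap ub >= 0 for |x|^2 > P,
   and Lap ub >= -2D everywhere.  For P = 16 M, U = ub - lam * ua (. - y) then
   satisfies Lap U >= lam c [x = y] outside the fixed ball |x|^2 < B, where
   Lap U >= -3D.  Since sum_x h Lap U = sum_x U Lap h = 0, h(y) is bounded by a
   constant times the sum of h over |x|^2 < B, hence by a constant times h(0).
   A bounded number of such steps, or of neighbour steps when r is small, joins
   any point of B(x0, r/2) to x0.  Here Lap f(x) = sum_(y ~ x) (f(y) - f(x)),
   which is -2d times the normalised Laplacian of the statement. *)

(** * Taylor bounds for (1 - t)^(-s) near t = 0 *)

Section Taylor.
Variable R : realFieldType.
Implicit Types (s : nat) (t : R).

(** Induction on s after clearing the denominator: (1 + (s+1) t)(1 - t) = 1 + s t - (s+1) t^2. *)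
Lemma invpow_tangent_le s t : t < 1 -> 1 + s%:R * t <= (1 - t) ^- s.
Proof.
move=> t1; have p1 : 0 < 1 - t by lra.
rewrite -[_ ^- s]mul1r ler_pdivlMr ?exprn_gt0//.
elim: s => [|s IH]; first by rewrite expr0; lra.
apply: le_trans IH; rewrite (exprS (1 - t)) [leLHS]mulrA.
rewrite ler_wpM2r ?exprn_ge0 ?(ltW p1)//.
have := sqr_ge0 t; have : 0 <= s%:R :> R by []; rewrite -(natr1 s); nra.
Qed.

Lemma invpow_tangent_ge s : exists2 K : R, 0 <= K &
  forall t, `|t| <= 1 / 2 -> (1 - t) ^- s <= 1 + s%:R * t + K * t ^+ 2.
Proof.
suff [K K0 H] : exists2 K : R, 0 <= K & forall t, `|t| <= 1 / 2 ->
    1 <= (1 + s%:R * t + K * t ^+ 2) * (1 - t) ^+ s.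
  exists K => // t ht; have : `|t| < 1 by lra.
  rewrite ltr_norml => /andP[_ t1].
  by rewrite -[_ ^- s]mul1r ler_pdivrMr ?exprn_gt0 ?subr_gt0//; exact: H.
elim: s => [|s [K K0 H]]; first by exists 0 => // t _; rewrite expr0; lra.
(* With K' the new constant, (1 + (s+1) t + K' t^2)(1 - t) = 1 + s t + (K' (1 - t) - (s+1)) t^2.
   Since 1 - t >= 1/2, the doubled sum leaves at least K t^2. *)
exists (2 * (K + s.+1%:R)); first by rewrite mulr_ge0// addr_ge0.
move=> t ht; apply: le_trans (H t ht) _.
move: ht; rewrite ler_norml => /andP[t0 t1].
rewrite (exprS (1 - t)) [leRHS]mulrA ler_wpM2r ?exprn_ge0//; first by lra.
have t2 : 0 <= t ^+ 2 by apply: sqr_ge0.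
have : 0 <= (1 / 2 - t) * (t ^+ 2 * (K + s.+1%:R)).
  by apply: mulr_ge0; [lra | rewrite mulr_ge0 ?addr_ge0].
rewrite -(natr1 s); nra.
Qed.

(** The third-order Taylor polynomial of (1 - t)^(-s) at 0. *)
Definition cubic_jet s t : R := 1 + s%:R * t + s%:R * (s%:R + 1) / 2 * t ^+ 2
  + s%:R * (s%:R + 1) * (s%:R + 2) / 6 * t ^+ 3.

Lemma cubic_jetS s t : cubic_jet s.+1 t * (1 - t) =
  cubic_jet s t - (s%:R + 1) * (s%:R + 2) * (s%:R + 3) / 6 * t ^+ 4.
Proof. by rewrite /cubic_jet -(natr1 s); field. Qed.

(** The induction of the tangent bound, one order pair higher: the defect in [cubic_jetS] is a
    nonnegative multiple of t^4, whatever the sign of t. *)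
Lemma invpow_cubic_le s t : t < 1 -> cubic_jet s t <= (1 - t) ^- s.
Proof.
move=> t1; have p1 : 0 < 1 - t by lra.
rewrite -[_ ^- s]mul1r ler_pdivlMr ?exprn_gt0//.
elim: s => [|s IH]; first by rewrite expr0 /cubic_jet; lra.
apply: le_trans IH; rewrite (exprS (1 - t)) [leLHS]mulrA.
rewrite ler_wpM2r ?exprn_ge0 ?(ltW p1)//.
rewrite cubic_jetS gerBl mulr_ge0 ?exprn_even_ge0//.
by rewrite divr_ge0 ?mulr_ge0 ?addr_ge0.
Qed.

Lemma invpow_cubic_ge s : exists2 K : R, 0 <= K &
  forall t, `|t| <= 1 / 2 -> (1 - t) ^- s <= cubic_jet s t + K * t ^+ 4.
Proof.
suff [K K0 H] : exists2 K : R, 0 <= K & forall t, `|t| <= 1 / 2 ->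
    1 <= (cubic_jet s t + K * t ^+ 4) * (1 - t) ^+ s.
  exists K => // t ht; have : `|t| < 1 by lra.
  rewrite ltr_norml => /andP[_ t1].
  by rewrite -[_ ^- s]mul1r ler_pdivrMr ?exprn_gt0 ?subr_gt0//; exact: H.
elim: s => [|s [K K0 H]].
  by exists 0 => // t _; rewrite expr0 /cubic_jet; lra.
pose c : R := (s%:R + 1) * (s%:R + 2) * (s%:R + 3) / 6.
have c0 : 0 <= c by rewrite divr_ge0 ?mulr_ge0 ?addr_ge0.
exists (2 * (K + c)); first by rewrite mulr_ge0// addr_ge0.
move=> t ht; apply: le_trans (H t ht) _.
move: ht; rewrite ler_norml => /andP[t0 t1].
rewrite (exprS (1 - t)) [leRHS]mulrA ler_wpM2r ?exprn_ge0//; first by lra.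
have t4 : 0 <= t ^+ 4 by rewrite exprn_even_ge0.
have : 0 <= (1 / 2 - t) * (t ^+ 4 * (K + c)).
  by apply: mulr_ge0; [lra | rewrite mulr_ge0 ?addr_ge0].
have := cubic_jetS s t; rewrite -/c; nra.
Qed.

(** The odd terms of the jets at t and -t cancel. *)
Lemma invpow_sym_le s t : `|t| < 1 ->
  2 + s%:R * (s%:R + 1) * t ^+ 2 <= (1 + t) ^- s + (1 - t) ^- s.
Proof.
rewrite ltr_norml => /andP[t0 t1].
have A := invpow_cubic_le s t1.
have /(invpow_cubic_le s) : - t < 1 by lra.
rewrite opprK => B; apply: le_trans (lerD B A).
by rewrite le_eqVlt; apply/orP; left; apply/eqP; rewrite /cubic_jet; field.
Qed.

Lemma invpow_sym_ge s : exists2 K : R, 0 <= K & forall t, `|t| <= 1 / 2 ->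
  (1 + t) ^- s + (1 - t) ^- s <= 2 + s%:R * (s%:R + 1) * t ^+ 2 + K * t ^+ 4.
Proof.
have [K K0 H] := invpow_cubic_ge s; exists (2 * K); first by rewrite mulr_ge0.
move=> t ht; have A := H _ ht.
have /H : `|- t| <= 1 / 2 by rewrite normrN.
rewrite opprK => B; apply: le_trans (lerD B A) _.
by rewrite le_eqVlt; apply/orP; left; apply/eqP; rewrite /cubic_jet; field.
Qed.

End Taylor.

(** * Second differences of r^(-s) *)

Section SecondDifference.
Variables (R : realFieldType) (s : nat).
Implicit Types q t m r : R.

Lemma invpow_scale q t : q != 0 -> (q + t) ^- s = q ^- s * (1 + t / q) ^- s.
Proof.
by move=> q0; rewrite -invfM -exprMn mulrDr mulr1 mulrC divfK// addrC.
Qed.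

Lemma invpow_tangent_scale m r : 0 < m -> 0 < r ->
  m ^- s * (1 + s%:R * (1 - r / m)) <= r ^- s.
Proof.
move=> m0 r0.
have -> : r ^- s = m ^- s * (1 - (1 - r / m)) ^- s.
  by rewrite subKr -invfM -exprMn mulrC divfK// gt_eqF.
rewrite ler_wpM2l ?invr_ge0 ?exprn_ge0 ?(ltW m0)// invpow_tangent_le//.
by rewrite ltrBlDr ltrDl divr_gt0.
Qed.

(* With rho = |x|^2 + a, q = rho + 1 and t = 2 x_i, the left-hand side is the
   second difference of rho^(-s) in direction i. *)
Lemma second_diff_ge : exists2 K : R, 0 <= K & forall q t,
  1 < q -> `|t| <= q / 2 ->
  (q + t) ^- s + (q - t) ^- s - 2 * (q - 1) ^- s <=
  q ^- s * (s%:R * (s%:R + 1) * (t / q) ^+ 2 + K * (t / q) ^+ 4 - 2 * s%:R / q).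
Proof.
have [K K0 H] := invpow_sym_ge R s; exists K => // q t q1 tq.
have q0 : 0 < q by lra.
have qn0 : q != 0 by rewrite gt_eqF.
have th : `|t / q| <= 1 / 2.
  by rewrite normrM normfV (gtr0_norm q0) ler_pdivrMr//; lra.
rewrite (invpow_scale t)// (invpow_scale (- t))// (invpow_scale (- 1))//
  mulrCA -mulrDr -mulrBr ler_wpM2l ?invr_ge0 ?exprn_ge0 ?(ltW q0)//.
have := H _ th; rewrite !mulNr.
have : 1 / q < 1 by rewrite ltr_pdivrMr// mul1r.
by move=> /(invpow_tangent_le s) A B; lra.
Qed.

(** The opposite Taylor bounds are used here, with rho = |x|^2 - b in mind and again q = rho + 1.
    The term K / q^2 is the quadratic error in expanding (q - 1)^(-s), for which 1 / q <= 1/2 is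
    required. *)
Lemma second_diff_le : exists2 K : R, 0 <= K & forall q t,
  2 <= q -> `|t| <= q / 2 ->
  q ^- s * (s%:R * (s%:R + 1) * (t / q) ^+ 2 - 2 * s%:R / q - K / q ^+ 2) <=
  (q + t) ^- s + (q - t) ^- s - 2 * (q - 1) ^- s.
Proof.
have [K K0 H] := invpow_tangent_ge R s; exists (2 * K).
  by rewrite mulr_ge0.
move=> q t q1 tq.
have q0 : 0 < q by lra.
have qn0 : q != 0 by rewrite gt_eqF.
have th : `|t / q| < 1.
  by rewrite normrM normfV (gtr0_norm q0) ltr_pdivrMr//; lra.
rewrite (invpow_scale t)// (invpow_scale (- t))// (invpow_scale (- 1))//
  [X in _ <= _ - X]mulrCA -[X in _ <= X - _]mulrDr -[X in _ <= X]mulrBr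
  ler_wpM2l ?invr_ge0 ?exprn_ge0 ?(ltW q0)//.
have := invpow_sym_le s th; rewrite !mulNr.
have : `|1 / q| <= 1 / 2.
  by rewrite gtr0_norm ?divr_gt0// ler_pdivrMr//; lra.
move=> /H A B.
have -> : 2 * K / q ^+ 2 = 2 * (K * (1 / q) ^+ 2) by field.
by lra.
Qed.

End SecondDifference.

(** * The lattice Laplacian and the squared Euclidean norm *)

Section Lattice.
Variables (R : realType) (D : nat).
Implicit Types (x y : 'rV[int]_D) (i : 'I_D) (f : 'rV[int]_D -> R).

Definition unit_vec i : 'rV[int]_D := delta_mx 0 i.

Definition lap f x : R :=
  \sum_(i < D) (f (x + unit_vec i) + f (x - unit_vec i) - 2 * f x).

Definition sqn x : R := \sum_(i < D) (x 0 i)%:~R ^+ 2.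

Lemma sum_unit_vec (F : 'I_D -> R) i :
  \sum_(j < D) F j * (unit_vec i 0 j)%:~R = F i.
Proof.
rewrite (bigD1 i)//= big1 => [|j ji]; rewrite mxE eqxx.
  by rewrite eqxx mulr1 addr0.
by rewrite (negPf ji) mulr0.
Qed.

Lemma sqn_unit_vec i : sqn (unit_vec i) = 1.
Proof.
by rewrite /sqn; under eq_bigr do rewrite expr2;
  rewrite sum_unit_vec mxE !eqxx.
Qed.

Lemma sqnN x : sqn (- x) = sqn x.
Proof. by apply: eq_bigr => i _; rewrite mxE rmorphN sqrrN. Qed.

Lemma sqnD x y : sqn (x + y) =
  sqn x + 2 * (\sum_(i < D) (x 0 i)%:~R * (y 0 i)%:~R) + sqn y.
Proof.
rewrite /sqn mulr_sumr -!big_split/=; apply: eq_bigr => i _.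
by rewrite mxE rmorphD/=; ring.
Qed.

Lemma sqnD_unit x i : sqn (x + unit_vec i) = sqn x + 1 + 2 * (x 0 i)%:~R.
Proof. by rewrite sqnD sqn_unit_vec sum_unit_vec addrAC. Qed.

Lemma sqnB_unit x i : sqn (x - unit_vec i) = sqn x + 1 - 2 * (x 0 i)%:~R.
Proof.
rewrite sqnD sqnN sqn_unit_vec.
under eq_bigr do rewrite mxE rmorphN mulrN.
by rewrite sumrN sum_unit_vec mulrN addrAC.
Qed.

Lemma sqn0 : sqn 0 = 0.
Proof. by rewrite /sqn big1// => i _; rewrite mxE expr0n. Qed.

Lemma sqn_ge0 x : 0 <= sqn x.
Proof. by apply: sumr_ge0 => i _; rewrite sqr_ge0. Qed.

Lemma sqr_coord_le x i : (x 0 i)%:~R ^+ 2 <= sqn x.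
Proof.
by rewrite /sqn (bigD1 i)//= lerDl sumr_ge0// => j _; rewrite sqr_ge0.
Qed.

Lemma sum_pow4_le x : \sum_(i < D) (x 0 i)%:~R ^+ 4 <= sqn x ^+ 2.
Proof.
rewrite expr2 {1}/sqn mulr_suml; apply: ler_sum => i _.
by rewrite (exprM _ 2 2) [leLHS]expr2 ler_wpM2l ?sqr_ge0// sqr_coord_le.
Qed.

Lemma sqnD_le x y : sqn (x + y) <= 2 * sqn x + 2 * sqn y.
Proof.
rewrite /sqn !mulr_sumr -big_split/=; apply: ler_sum => i _.
by rewrite mxE rmorphD/=; have := sqr_ge0 ((x 0 i)%:~R - (y 0 i)%:~R : R); nra.
Qed.

Lemma lap_radial (g : R -> R) x : lap (fun z => g (sqn z)) x =
  \sum_(i < D) (g (sqn x + 1 + 2 * (x 0 i)%:~R) +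
     g (sqn x + 1 - 2 * (x 0 i)%:~R) - 2 * g (sqn x)).
Proof. by apply: eq_bigr => i _; rewrite sqnD_unit sqnB_unit. Qed.

Lemma lapB f g (c : R) x : lap (fun z => f z - c * g z) x = lap f x - c * lap g x.
Proof.
by rewrite /lap mulr_sumr -sumrB; apply: eq_bigr => i _; ring.
Qed.

(** * Superharmonic and subharmonic radial functions in dimension 2s + 2 *)

Section EvenDimension.
Variable s : nat.
Hypotheses (s0 : (0 < s)%N) (DE : D = (2 * s.+1)%N).

Let DR : D%:R = 2 * (s%:R + 1) :> R.
Proof. by rewrite DE natrM natr1. Qed.

Let sR : 1 <= s%:R :> R.
Proof. by rewrite ler1n. Qed.

(** Summed over directions, the second-order terms are 4s(s+1)|x|^2 / q^2 and -4s(s+1) / q, because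
    D = 2(s+1). What remains of them is -4s(s+1)(a+1) / q^2, and this beats the quartic error, at
    most 16 K / q^2, once a = 4 + 16 K. The 4 ensures |2 x_i| <= q / 2. *)
Lemma lap_green_le0 : exists2 a : R, 4 <= a &
  forall x, lap (fun z => (sqn z + a) ^- s) x <= 0.
Proof.
have [K K0 H] := second_diff_ge R s.
exists (4 + 16 * K); first by lra.
set a := 4 + _ => x.
rewrite (lap_radial (fun r => (r + a) ^- s)).
set q := sqn x + a + 1; have N0 := sqn_ge0 x.
have q1 : 1 < q by rewrite /q /a; lra.
have qn0 : q != 0 by rewrite gt_eqF//; lra.
apply: (@le_trans _ _ (\sum_(i < D) (q ^- s *
    ((4 * s%:R * (s%:R + 1) / q ^+ 2) * (x 0 i)%:~R ^+ 2
    + 16 * K / q ^+ 4 * (x 0 i)%:~R ^+ 4 - 2 * s%:R / q)))).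
  apply: ler_sum => i _.
  have A := sqr_coord_le x i.
  have : `|2 * (x 0 i)%:~R| <= q / 2.
    have B1 := sqr_ge0 ((x 0 i)%:~R - 2 : R).
    have B2 := sqr_ge0 ((x 0 i)%:~R + 2 : R).
    by rewrite ler_norml; apply/andP; rewrite /q /a; split; nra.
  move=> /(H _ _ q1).
  have -> : q - 1 = sqn x + a by rewrite /q; lra.
  have -> : q + 2 * (x 0 i)%:~R = sqn x + 1 + 2 * (x 0 i)%:~R + a.
    by rewrite /q; lra.
  have -> : q - 2 * (x 0 i)%:~R = sqn x + 1 - 2 * (x 0 i)%:~R + a.
    by rewrite /q; lra.
  move=> /le_trans; apply; rewrite ler_wpM2l ?invr_ge0 ?exprn_ge0//; last first.
    by rewrite le_eqVlt; apply/orP; left; apply/eqP; field.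
  by lra.
rewrite -mulr_sumr mulr_ge0_le0 ?invr_ge0 ?exprn_ge0//; first by lra.
rewrite sumrB big_split/= -!mulr_sumr sumr_const card_ord -/(sqn x).
set S4 := \sum_i _.
have S4le : S4 <= q ^+ 2.
  apply: le_trans (sum_pow4_le x) _; rewrite ler_sqr ?nnegrE//; rewrite /q /a; lra.
rewrite -(mulr_natr _ D) DR.
rewrite [leLHS](_ : _ = (4 * s%:R * (s%:R + 1) * (sqn x - q) +
  16 * K * (S4 / q ^+ 2)) / q ^+ 2); last by field.
rewrite mulr_le0_ge0 ?invr_ge0 ?sqr_ge0//.
have : S4 / q ^+ 2 <= 1 by rewrite ler_pdivrMr ?mul1r// exprn_gt0//; lra.
move=> /(ler_wpM2l K0) B.
have s1 : 1 <= s%:R * (s%:R + 1) :> R by have := sR; nra.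
have : 0 <= (s%:R * (s%:R + 1) - 1) * (5 + 16 * K).
  by apply: mulr_ge0; lra.
rewrite /q /a; lra.
Qed.

(** The sum is the Laplacian of (|x|^2 - b)^(-s), expanded as in [lap_radial]. The second-order
    terms now leave a multiple of 2s(b - 1) - K, which is nonnegative for b = 1 + K; the lower bound
    on |x|^2 gives |2 x_i| <= q / 2. *)
Lemma lap_green_ge0 : exists2 b : R, 1 <= b &
  forall x, 2 * b + 32 <= sqn x ->
    (0 <= \sum_(i < D) ((sqn x + 1 + 2 * (x 0 i)%:~R - b) ^- s +
     (sqn x + 1 - 2 * (x 0 i)%:~R - b) ^- s - 2 * (sqn x - b) ^- s)).
Proof.
have [K K0 H] := second_diff_le R s.
exists (1 + K); first by lra.
set b := 1 + K => x xb.
set q := sqn x - b + 1.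
have q2 : 2 <= q by rewrite /q /b; rewrite /b in xb; lra.
have qn0 : q != 0 by rewrite gt_eqF//; lra.
apply: (@le_trans _ _ (\sum_(i < D) (q ^- s *
    ((4 * s%:R * (s%:R + 1) / q ^+ 2) * (x 0 i)%:~R ^+ 2
    - (2 * s%:R / q + K / q ^+ 2))))); last first.
  apply: ler_sum => i _.
  have A := sqr_coord_le x i.
  have : `|2 * (x 0 i)%:~R| <= q / 2.
    have B1 := sqr_ge0 ((x 0 i)%:~R - 4 : R).
    have B2 := sqr_ge0 ((x 0 i)%:~R + 4 : R).
    by rewrite ler_norml; apply/andP; rewrite /q; rewrite /b in xb *; split; nra.
  move=> /(H _ _ q2).
  have -> : q - 1 = sqn x - b by rewrite /q; lra.
  have -> : q + 2 * (x 0 i)%:~R = sqn x + 1 + 2 * (x 0 i)%:~R - b.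
    by rewrite /q; lra.
  have -> : q - 2 * (x 0 i)%:~R = sqn x + 1 - 2 * (x 0 i)%:~R - b.
    by rewrite /q; lra.
  apply: le_trans; rewrite ler_wpM2l ?invr_ge0 ?exprn_ge0//; last first.
    by rewrite le_eqVlt; apply/orP; left; apply/eqP; field.
  by lra.
rewrite -mulr_sumr mulr_ge0 ?invr_ge0 ?exprn_ge0//; first by lra.
rewrite sumrB -!mulr_sumr sumr_const card_ord -/(sqn x).
rewrite -(mulr_natr _ D) DR.
rewrite [leRHS](_ : _ = (2 * (s%:R + 1)) *
  (2 * s%:R * (sqn x - q) - K) / q ^+ 2); last by field.
have s1 := sR.
rewrite divr_ge0 ?sqr_ge0// mulr_ge0//; first by lra.
have : 0 <= K * (s%:R - 1) by apply: mulr_ge0; lra.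
by rewrite /q /b; nra.
Qed.

End EvenDimension.
End Lattice.

(** * The truncated kernels ua and ub *)

Section Kernels.
Variables (R : realType) (D : nat).
Implicit Types (x y : 'rV[int]_D) (i : 'I_D) (f : 'rV[int]_D -> R).
Notation sqn := (@sqn R D).

Lemma lap_le_nbr f g x : g x = f x ->
  (forall i, f (x + unit_vec i) <= g (x + unit_vec i)) ->
  (forall i, f (x - unit_vec i) <= g (x - unit_vec i)) -> lap f x <= lap g x.
Proof. by move=> fg A B; apply: ler_sum => i _; rewrite fg lerB// lerD. Qed.

Lemma lap_affine f (a b : R) x :
  lap (fun z => f z + (a + b * sqn z)) x = lap f x + 2 * b * D%:R.
Proof.
have -> : 2 * b * D%:R = \sum_(i < D) 2 * b.
  by rewrite sumr_const card_ord mulr_natr.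
rewrite /lap -big_split/=.
by apply: eq_bigr => i _; rewrite sqnD_unit sqnB_unit; ring.
Qed.

Section EvenDimension.
Variable s : nat.
Hypotheses (s0 : (0 < s)%N) (DE : D = (2 * s.+1)%N).

Let sR : 1 <= s%:R :> R.
Proof. by rewrite ler1n. Qed.

Lemma upper_kernel : exists C c : R, [/\ 0 <= C, 0 < c & forall M, 36 <= M ->
  exists u, (forall x, M < sqn x -> u x = 0) /\
    (forall x, lap u x <= C * M ^- s.+1 - c * (x == 0)%:R)].
Proof.
have [a a4 gle0] := lap_green_le0 R s0 DE.
have [K K0 HK] := invpow_tangent_ge R s.
pose green z := (sqn z + a) ^- s.
(* The first summand bounds the Laplacian of the affine part of [v] inside |x|^2 <= M; the second
   bounds the effect of the cut-off at points just outside. *)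
exists (2 * D%:R * s%:R + 18 * D%:R * K), (- lap green 0); split.
- by rewrite addr_ge0// !mulr_ge0.
- rewrite oppr_gt0 /green (lap_radial (fun r => (r + a) ^- s)) sqn0 add0r.
  under eq_bigr do rewrite mxE mulr0 subr0 addr0.
  rewrite sumr_const card_ord -(mulr_natr _ D) pmulr_llt0 ?ltr0n ?DE// subr_lt0 add0r.
  rewrite -mulr2n -(mulr_natl (_ ^- s) 2) ltr_pM2l// ltf_pV2 ?posrE ?exprn_gt0//; try lra.
  by rewrite ltrXn2r -?lt0n// ?nnegrE; lra.
move=> M M36; set m := M + a.
have m0 : 0 < m by rewrite /m; lra.
have mn0 : m != 0 by rewrite gt_eqF.
have ms0 : 0 <= m ^- s by rewrite invr_ge0 exprn_ge0// ltW.
(* v is the gap between the convex function rho^(-s) and its tangent at m, so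
   cutting it off at rho = m costs only a second-order term. *)
pose v z := green z - m ^- s * (1 + s%:R * (1 - (sqn z + a) / m)).
have v0 z : 0 <= v z.
  by rewrite subr_ge0 invpow_tangent_scale//; have := sqn_ge0 R z; lra.
pose u z := if sqn z <= M then v z else 0.
have uv z : u z <= v z by rewrite /u; case: ifP.
have uN z : M < sqn z -> u z = 0 by rewrite /u leNgt => ->.
have mM : m ^- s / m <= M ^- s.+1.
  rewrite -invfM -exprSr lef_pV2 ?posrE ?exprn_gt0//; try lra.
  by rewrite lerXn2r ?nnegrE// /m; lra.
exists u; split => // x.
have vE : lap v x = lap green x + 2 * (m ^- s * s%:R / m) * D%:R.
  rewrite -(lap_affine green (m ^- s * (s%:R * (a / m - 1) - 1))).
  by apply: eq_bigr => i _; rewrite /v; move: (m ^- s) => w; field.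
have [xM|xM] := leP (sqn x) M.
  have ux : lap u x <= lap v x.
    by apply: lap_le_nbr => //; rewrite /u xM.
  apply: le_trans ux _; rewrite vE.
  have Cle : 2 * (m ^- s * s%:R / m) * D%:R <=
      (2 * D%:R * s%:R + 18 * D%:R * K) * M ^- s.+1.
    rewrite [leRHS]mulrDl ler_wpDr ?mulr_ge0 ?invr_ge0 ?exprn_ge0//; first by lra.
    rewrite [leLHS](_ : _ = 2 * D%:R * s%:R * (m ^- s / m)); last first.
      by move: (m ^- s) => w; field.
    by rewrite ler_wpM2l// !mulr_ge0.
  rewrite addrC lerD//; have [->|_] := eqVneq x 0; first by rewrite mulr1 opprK.
  by rewrite mulr0 oppr0.
have x0 : x != 0 by apply: contraTneq xM => ->; rewrite sqn0 -leNgt; lra.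
rewrite (negPf x0) mulr0 subr0.
(* Here y is a neighbour of x and t its coordinate in the direction of the step. As |x|^2 > M, the
   gap M - |y|^2 is at most 1 + 2|t|, so tau = (M - |y|^2) / m satisfies tau^2 <= 9 / m. The bound M
   >= 36 then gives tau <= 1/2, and [v y] is a Taylor remainder of order tau^2. *)
have ule y (t : R) : `|sqn x - sqn y| <= 1 + 2 * `|t| -> t ^+ 2 <= sqn y ->
    u y <= 9 * K * (m ^- s / m).
  move=> xy ty; rewrite /u; case: ifP => [yM|_]; last first.
    by rewrite !mulr_ge0// invr_ge0 ltW.
  pose tau := (M - sqn y) / m.
  have d1 : M - sqn y <= 1 + 2 * `|t|.
    by apply: le_trans xy; rewrite ger0_norm; lra.
  have tau0 : 0 <= tau by rewrite divr_ge0 ?subr_ge0// ltW.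
  have d2 : (M - sqn y) ^+ 2 <= 9 * m.
    rewrite -(real_normK (num_real t)) in ty.
    apply: (@le_trans _ _ ((1 + 2 * `|t|) ^+ 2)).
      by rewrite ler_sqr ?nnegrE ?subr_ge0// addr_ge0// mulr_ge0.
    by have := sqr_ge0 (`|t| - 1 : R); rewrite /m; nra.
  have tau2 : tau ^+ 2 <= 9 / m.
    rewrite exprMn exprVn ler_pdivrMr ?exprn_gt0//.
    by rewrite (_ : 9 / m * m ^+ 2 = 9 * m)//; field.
  have m36 : 9 / m <= 1 / 4 by rewrite ler_pdivrMr// /m; lra.
  have tau12 : `|tau| <= 1 / 2.
    rewrite ger0_norm// -ler_sqr ?nnegrE//; first by apply: le_trans tau2 _; lra.
    by lra.
  have -> : v y = m ^- s * ((1 - tau) ^- s - (1 + s%:R * tau)).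
    rewrite mulrBr -invfM -exprMn; congr (_ ^- s - _ * (1 + _ * _)).
      by rewrite /tau /m; field.
    by rewrite /tau /m; field.
  have := HK _ tau12; rewrite -lerBlDl => /(ler_wpM2l ms0) /le_trans; apply.
  rewrite (_ : 9 * K * _ = m ^- s * (K * (9 / m))); last first.
    by move: (m ^- s) => w; field.
  by rewrite ler_wpM2l// ler_wpM2l.
have key i : u (x + unit_vec i) + u (x - unit_vec i) - 2 * u x <=
    18 * K * (m ^- s / m).
  rewrite (uN x)// mulr0 subr0.
  have /ule A : `|sqn x - sqn (x + unit_vec i)| <=
      1 + 2 * `|((x + unit_vec i) 0 i)%:~R|.
    rewrite -{1}[x](addrK (unit_vec i)) sqnB_unit.
    set w := _%:~R; rewrite [X in `|X|](_ : _ = 1 - 2 * w); last by ring.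
    by apply: le_trans (ler_normB _ _) _; rewrite normr1 normrM normr_nat.
  have /ule B : `|sqn x - sqn (x - unit_vec i)| <=
      1 + 2 * `|((x - unit_vec i) 0 i)%:~R|.
    rewrite -{1}[x](subrK (unit_vec i)) sqnD_unit.
    set w := _%:~R; rewrite [X in `|X|](_ : _ = 1 + 2 * w); last by ring.
    by apply: le_trans (ler_normD _ _) _; rewrite normr1 normrM normr_nat.
  have {}A := A (sqr_coord_le _ _ _).
  have {}B := B (sqr_coord_le _ _ _).
  by lra.
apply: le_trans (ler_sum _ (fun i _ => key i)) _.
rewrite sumr_const card_ord -(mulr_natr (18 * K * (m ^- s / m)) D).
have q0 : 0 <= m ^- s / m by rewrite divr_ge0// ltW.
apply: (@le_trans _ _ (18 * D%:R * K * M ^- s.+1)); last first.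
  by rewrite [leRHS]mulrDl lerDr !mulr_ge0// invr_ge0 exprn_ge0//; lra.
rewrite [leLHS](_ : _ = 18 * D%:R * K * (m ^- s / m)); last first.
      by move: (m ^- s) => w; field.
by rewrite ler_wpM2l// !mulr_ge0.
Qed.

Lemma lower_kernel : exists B P0 : R, [/\ 0 <= B, 0 < P0 & forall P, P0 <= P ->
  exists u, [/\ forall x, P < sqn x -> u x = 0,
    forall x, - (2 * D%:R) <= lap u x,
    forall x, B <= sqn x -> 0 <= lap u x &
    forall x, B <= sqn x <= P -> D%:R * P ^- s.+1 <= lap u x]].
Proof.
have s1 := sR; have [b b1 gge0] := lap_green_ge0 R s0 DE.
(* The second value keeps |y|^2 - b <= 2p for every neighbour y of a point with |z|^2 <= P, the
   range where [phi] is known to be nonpositive beyond p. *)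
exists (2 * b + 32), (2 * b + 10); split; [lra|lra|].
move=> P PP0; set p := P - b.
have pb : b + 10 <= p by rewrite /p; lra.
have p0 : 0 < p by lra.
have pn0 : p != 0 by rewrite gt_eqF.
have ps0 : 0 <= p ^- s by rewrite invr_ge0 exprn_ge0// ltW.
(* p^s phi(p v) = v^(-s) + v / 2 - 3 / 2 is nonnegative for v <= 1 and nonpositive
   on [1, 2]; the linear term makes ub strictly subharmonic. *)
pose phi (r : R) := r ^- s + (p ^- s / p / 2 * r - 3 / 2 * p ^- s).
(* The maximum avoids the singularity at |z|^2 = b; it is inactive at points with |z|^2 >= 2b + 32
   and at their neighbours. *)
pose sg z := Num.max (sqn z - b) 1.
have sg1 z : 1 <= sg z by rewrite le_max lexx orbT.
have sgP z : sqn z <= P -> sg z <= p.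
  by move=> zP; rewrite ge_max /p; apply/andP; split; lra.
have phi_ge0 r : 1 <= r <= p -> 0 <= phi r.
  move=> /andP[r1 rp].
  have := @invpow_tangent_scale _ s p r p0; rewrite /phi.
  have : r / p <= 1 by rewrite ler_pdivrMr ?mul1r.
  move: ps0; set w := p ^- s; set v := r ^- s => ps0 rp1 A.
  have {}A : w * (1 + s%:R * (1 - r / p)) <= v by apply: A; lra.
  have : 0 <= w * ((s%:R - 1) * (1 - r / p)).
    by rewrite mulr_ge0// mulr_ge0//; lra.
  have : 0 <= w * (1 - r / p) by rewrite mulr_ge0//; lra.
  rewrite (_ : w / p / 2 * r = w * (r / p) / 2); last by field.
  by lra.
have phi_le1 r : 1 <= r <= p -> phi r <= 1.
  move=> /andP[r1 rp]; rewrite /phi.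
  have : r / p <= 1 by rewrite ler_pdivrMr ?mul1r.
  have : r ^- s <= 1 by rewrite invf_le1 ?exprn_gt0 ?exprn_ege1//; lra.
  move: ps0; set w := p ^- s; set v := r ^- s => ps0 v1 rp1.
  rewrite (_ : w / p / 2 * r = w * (r / p) / 2); last by field.
  have : 0 <= w * (1 - r / p) by rewrite mulr_ge0//; lra.
  by lra.
have phi_le0 r : p <= r <= 2 * p -> phi r <= 0.
  move=> /andP[pr rp]; rewrite /phi.
  have r0 : 0 < r by lra.
  have rn0 : r != 0 by rewrite gt_eqF.
  have -> : r ^- s = p ^- s * (p / r) ^+ s.
    by rewrite exprMn exprVn mulKf// expf_neq0.
  have pr1 : p / r <= 1 by rewrite ler_pdivrMr ?mul1r.
  have : (p / r) ^+ s <= p / r.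
    by case: (s) s0 => // k _; rewrite exprS ler_piMr ?exprn_ile1// divr_ge0//; lra.
  (* With v = r / p in [1, 2], this is 1 / v <= 3/2 - v / 2, that is (v - 1)(2 - v) >= 0. *)
  have : (p / r) * 1 <= (p / r) * (3 / 2 * (r / p) - (r / p) ^+ 2 / 2).
    rewrite ler_wpM2l ?divr_ge0//; [lra|lra|].
    have A : 1 <= r / p by rewrite ler_pdivlMr ?mul1r.
    have B : r / p <= 2 by rewrite ler_pdivrMr.
    have : 0 <= (r / p - 1) * (2 - r / p) by rewrite mulr_ge0//; lra.
    by lra.
  rewrite (_ : p / r * (3 / 2 * (r / p) - (r / p) ^+ 2 / 2) =
     3 / 2 - r / p / 2); last by field; rewrite pn0 rn0.
  move=> A B.
  have : (p / r) ^+ s <= 3 / 2 - r / p / 2 by lra.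
  move=> /(ler_wpM2l ps0); move: (p ^- s) ((p / r) ^+ s) => w v.
  rewrite (_ : w / p / 2 * r = w * (r / p) / 2); last by field.
  by lra.
pose u z := if sqn z <= P then phi (sg z) else 0.
have u0 z : 0 <= u z.
  by rewrite /u; case: ifP => // zP; rewrite phi_ge0// sg1 sgP.
have u1 z : u z <= 1.
  by rewrite /u; case: ifP => // zP; rewrite phi_le1// sg1 sgP.
have uN z : P < sqn z -> u z = 0 by rewrite /u leNgt => ->.
have lap_out z : P < sqn z -> 0 <= lap u z.
  move=> zP; apply: sumr_ge0 => i _.
  by rewrite (uN z)// mulr0 subr0 addr_ge0.
have lap_in z : 2 * b + 32 <= sqn z <= P -> D%:R * P ^- s.+1 <= lap u z.
  move=> /andP[zB zP].
  have coord i : 2 * `|(z 0 i)%:~R : R| <= sqn z / 4 + 4.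
    have := sqr_coord_le R z i; rewrite -(real_normK (num_real (z 0 i)%:~R)).
    by have := sqr_ge0 (`|(z 0 i)%:~R| - 4 : R); nra.
  (* [w] is the kernel without truncation. It equals [u] at z and is at most [u] at the neighbours,
     since it is nonpositive where [u] has been set to 0. Its linear term in |y|^2 contributes D
     p^(-s-1) to the Laplacian. *)
  pose w y := (sqn y - b) ^- s +
     ((- (p ^- s / p / 2 * b) - 3 / 2 * p ^- s) + p ^- s / p / 2 * sqn y).
  have wE y : 1 <= sqn y - b -> phi (sg y) = w y.
    move=> yb; rewrite /sg; move/max_idPl: yb => ->; rewrite /phi /w.
    by congr (_ + _); ring.
  have wu y (t : R) : sqn y = sqn z + 1 + 2 * t -> 2 * `|t| <= sqn z / 4 + 4 ->
      w y <= u y.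
    move=> yE; rewrite -normr_nat -normrM ler_norml => /andP[t1 t2].
    rewrite -wE; last by lra.
    rewrite /u; case: (leP (sqn y) P) => // yP; rewrite phi_le0// /sg.
    by rewrite le_max ge_max /p; apply/andP; split; [apply/orP; left|apply/andP; split]; lra.
  apply: (@le_trans _ _ (lap w z)); last first.
    apply: lap_le_nbr => [|i|i].
    - by rewrite /u zP wE//; lra.
    - by apply: (@wu _ (z 0 i)%:~R); rewrite ?sqnD_unit.
    - by apply: (@wu _ (- (z 0 i)%:~R)); rewrite ?sqnB_unit ?mulrN ?normrN.
  rewrite lap_affine (lap_radial (fun r => (r - b) ^- s)).
  rewrite ler_wpDl ?gge0//.
  rewrite (_ : 2 * _ * D%:R = D%:R * (p ^- s / p)); last first.
    by move: (p ^- s) => v; field.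
  rewrite ler_wpM2l// -invfM -exprSr lef_pV2 ?posrE ?exprn_gt0//; try lra.
  by rewrite lerXn2r ?nnegrE// /p; lra.
exists u; split => //.
- move=> x; rewrite (_ : - (2 * D%:R) = \sum_(i < D) (- 2)); last first.
    by rewrite sumr_const card_ord mulNrn mulr_natr.
  apply: ler_sum => i _.
  by have := u0 (x + unit_vec i); have := u0 (x - unit_vec i); have := u1 x; lra.
- move=> x xB; have [xP|xP] := leP (sqn x) P; last exact: lap_out.
  apply: le_trans (lap_in x _); last by rewrite xB.
  by rewrite mulr_ge0// invr_ge0 exprn_ge0//; lra.
Qed.

End EvenDimension.
End Kernels.

(** * The graph norm and its finite balls *)

Section Norm1.
Variable D : nat.
Implicit Types (x y : 'rV[int]_D) (i : 'I_D).

Definition norm1 x : nat := (\sum_(i < D) `|x 0%R i|)%N.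

Lemma norm1_0 : norm1 0 = 0%N.
Proof. by rewrite /norm1 big1// => i _; rewrite mxE. Qed.

Lemma norm1_eq0 x : norm1 x = 0%N -> x = 0.
Proof.
move=> x0; apply/rowP => i; rewrite mxE; apply/eqP.
move/eqP: x0; rewrite /norm1 sum_nat_eq0 => /forallP/(_ i).
by rewrite absz_eq0.
Qed.

Lemma norm1N x : norm1 (- x) = norm1 x.
Proof. by apply: eq_bigr => i _; rewrite mxE abszN. Qed.

Lemma norm1D_unit x i :
  (norm1 (x + unit_vec i) + `|x 0%R i| = norm1 x + `|(x 0 i + 1)%R|)%N.
Proof.
rewrite /norm1 (bigD1 i)//= [in RHS](bigD1 i)//= !mxE !eqxx.
rewrite (eq_bigr (fun j => `|x 0%R j|%N)); first last.
  by move=> j ji; rewrite !mxE (negPf ji) addr0.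
by rewrite /= addnAC [RHS]addnAC; congr addn; rewrite addnC.
Qed.

Lemma norm1B_unit x i :
  (norm1 (x - unit_vec i) + `|x 0%R i| = norm1 x + `|(x 0 i - 1)%R|)%N.
Proof.
have := norm1D_unit (- x) i; rewrite -[- x + _]opprK opprD opprK !norm1N.
by rewrite mxE abszN => ->; congr addn; rewrite -abszN opprD opprK.
Qed.

Lemma norm1D_unit_ge x i : (norm1 x <= (norm1 (x + unit_vec i)%R).+1)%N.
Proof. by have := norm1D_unit x i; lia. Qed.

Lemma norm1B_unit_ge x i : (norm1 x <= (norm1 (x - unit_vec i)%R).+1)%N.
Proof. by have := norm1B_unit x i; lia. Qed.

Lemma norm1_step x k : norm1 x = k.+1 ->
  exists x', norm1 x' = k /\ exists i, x = x' + unit_vec i \/ x = x' - unit_vec i.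
Proof.
move=> xk; have [i xi] : exists i, x 0 i != 0.
  apply/existsP; apply: contra_eqT xk; rewrite negb_exists => /forallP x0.
  by rewrite /norm1 big1// => i _; have /negPn/eqP -> := x0 i.
have [x0|x0] := ltP 0 (x 0 i).
  exists (x - unit_vec i); split; first by have := norm1B_unit x i; lia.
  by exists i; left; rewrite subrK.
exists (x + unit_vec i); split; first by have := norm1D_unit x i; lia.
by exists i; right; rewrite addrK.
Qed.

Lemma finite_norm1_ball n : finite_set [set x | (norm1 x <= n)%N].
Proof.
pose f (A : 'rV['I_(n + n).+1]_D) : 'rV[int]_D :=
  \row_i ((A 0 i : nat)%:Z - n%:Z).
apply: (@sub_finite_set _ _ (f @` setT)); last exact/finite_image/finite_finset.
move=> x /= xn.
have xi i : (`|x 0%R i| <= n)%N.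
  by apply: leq_trans xn; rewrite /norm1 (bigD1 i)//= leq_addr.
exists (\row_i inord (absz (x 0 i + n%:Z))) => //.
apply/rowP => i; rewrite !mxE inordK; have := xi i; lia.
Qed.

Definition norm1_ball n := fset_set [set x | (norm1 x <= n)%N].

Lemma in_norm1_ball n x : (x \in norm1_ball n) = (norm1 x <= n)%N.
Proof.
rewrite in_fset_set; last exact: finite_norm1_ball.
by apply/idP/idP => [/set_mem|/mem_set].
Qed.

End Norm1.

(** * Neighbour bounds for harmonic functions and summation by parts *)

Section Harmonic.
Variables (R : realType) (D : nat).
Implicit Types (x y : 'rV[int]_D) (i : 'I_D) (f h : 'rV[int]_D -> R).
Notation sqn := (@sqn R D).

Lemma norm1_sum x : (norm1 x)%:R = \sum_(i < D) `|(x 0 i)%:~R : R|.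
Proof. by rewrite natr_sum; apply: eq_bigr => i _; rewrite natr_absz intr_norm. Qed.

Lemma sqn_le_norm1 x : sqn x <= (norm1 x)%:R ^+ 2.
Proof.
rewrite expr2 {1}norm1_sum mulr_suml; apply: ler_sum => i _.
rewrite -(real_normK (num_real (x 0 i)%:~R)) expr2 ler_wpM2l//.
rewrite norm1_sum (bigD1 i)//= lerDl sumr_ge0//.
Qed.

Lemma norm1_le_radius x (r : R) : 0 <= r -> sqn x <= r ^+ 2 ->
  (norm1 x)%:R <= D%:R * r.
Proof.
move=> r0 xr; rewrite norm1_sum mulr_natl -[X in _ *+ X]card_ord -sumr_const.
apply: ler_sum => i _; rewrite -ler_sqr ?nnegrE// real_normK ?num_real//.
exact: le_trans (sqr_coord_le _ _ _) xr.
Qed.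

Lemma lap_shift f x y : lap (fun z => f (z - y)) x = lap f (x - y).
Proof.
by apply: eq_bigr => i _; rewrite !(addrAC x _ (- y)).
Qed.

Lemma lap_harmonicE h x : lap h x = 0 ->
  \sum_(i < D) (h (x + unit_vec i) + h (x - unit_vec i)) = 2 * D%:R * h x.
Proof.
rewrite /lap sumrB => /subr0_eq ->.
by rewrite sumr_const card_ord -(mulr_natr (2 * h x) D) mulrAC.
Qed.

Lemma harmonic_nbr_le h x i : lap h x = 0 ->
  (forall j, 0 <= h (x + unit_vec j)) -> (forall j, 0 <= h (x - unit_vec j)) ->
  h (x + unit_vec i) <= 2 * D%:R * h x /\ h (x - unit_vec i) <= 2 * D%:R * h x.
Proof.
move=> /lap_harmonicE <- hD hB; rewrite (bigD1 i)//=.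
have : 0 <= \sum_(j < D | j != i) (h (x + unit_vec j) + h (x - unit_vec j)).
  by apply: sumr_ge0 => j _; rewrite addr_ge0.
by have := hD i; have := hB i; split; lra.
Qed.

(** Follow a shortest path from 0 to x, losing a factor 2D per step. Each step starts at norm below
    n, so all neighbours involved have norm at most n. *)
Lemma harmonic_chain_le n h : (0 < D)%N ->
  (forall x, (norm1 x <= n)%N -> 0 <= h x) ->
  (forall x, (norm1 x <= n)%N -> lap h x = 0) ->
  forall k x, (norm1 x <= k <= n)%N -> h x <= (2 * D%:R) ^+ k * h 0.
Proof.
move=> D0 h0 hl k; elim: k => [|k IH] x /andP[xk kn].
  rewrite expr0 mul1r (_ : x = 0)//; apply: norm1_eq0.
  by apply/eqP; rewrite -leqn0.
have h00 : 0 <= h 0 by apply: h0; rewrite norm1_0.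
have d1 : 1 <= 2 * D%:R :> R.
  by rewrite -natrM ler1n muln_gt0.
case: (leqP (norm1 x) k) => [xk'|xk'].
  apply: le_trans (IH x _) _; first by rewrite xk' ltnW.
  by rewrite ler_wpM2r// ler_weXn2l.
have {xk'}xk : norm1 x = k.+1 by apply/eqP; rewrite eqn_leq xk.
have [x' [x'k [i xE]]] := norm1_step xk.
apply: (@le_trans _ _ (2 * D%:R * h x')); last first.
  by rewrite exprS -[leRHS]mulrA ler_wpM2l ?IH ?x'k ?leqnn ?(ltnW kn)// mulr_ge0.
have [|||A B] := @harmonic_nbr_le h x' i (hl _ _).
- by rewrite x'k ltnW.
- by move=> j; apply: h0; have := norm1D_unit x' j; lia.
- by move=> j; apply: h0; have := norm1B_unit x' j; lia.
by case: xE => ->.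
Qed.

(** [f] and its unit translates vanish off [A], so each sum extends to the whole lattice, where
    translation is a bijection. Hence nothing is asked of [h]. *)
Lemma sum_lap_by_parts (A : {fset 'rV[int]_D}) f h :
  (forall x, x \notin A -> f x = 0) ->
  (forall x i, x \notin A -> f (x + unit_vec i) = 0) ->
  (forall x i, x \notin A -> f (x - unit_vec i) = 0) ->
  \sum_(x <- A) lap f x * h x = \sum_(x <- A) f x * lap h x.
Proof.
move=> f0 fD fB.
have shift (v : 'rV[int]_D) : (forall x, x \notin A -> f (x + v) = 0) ->
    \sum_(x <- A) f (x + v) * h x = \sum_(x <- A) f x * h (x - v).
  move=> fv.
  have -> : \sum_(x <- A) f (x + v) * h x =
      \sum_(x \in [set: 'rV[int]_D]) f (x + v) * h x.
    by rewrite (fsbigTE A)// => x /fv ->; rewrite mul0r.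
  have -> : \sum_(x <- A) f x * h (x - v) =
      \sum_(x \in [set: 'rV[int]_D]) f x * h (x - v).
    by rewrite (fsbigTE A)// => x /f0 ->; rewrite mul0r.
  rewrite [RHS](@reindex_fsbigT _ _ _ _ _ (fun x => x + v)).
    by apply: eq_fsbigr => x _; rewrite addrK.
  by exists (fun x => x - v) => x; rewrite ?addrK ?subrK.
under eq_bigr do rewrite /lap mulr_suml.
under [RHS]eq_bigr do rewrite /lap mulr_sumr.
rewrite exchange_big [RHS]exchange_big/=; apply: eq_bigr => i _.
under eq_bigr do rewrite mulrBl mulrDl.
under [RHS]eq_bigr do rewrite mulrBr mulrDr.
rewrite !sumrB !big_split/= !shift//; last first.
- by move=> x xA; apply: fD.
- by move=> x xA; apply: fB.
rewrite opprK; congr (_ - _); first by rewrite addrC.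
by apply: eq_bigr => x _; ring.
Qed.

End Harmonic.

(** * Comparison with the value at the centre in even dimension *)

Section Harnack.
Variables (R : realType) (D : nat).
Implicit Types (x y : 'rV[int]_D) (i : 'I_D) (f h : 'rV[int]_D -> R).
Notation sqn := (@sqn R D).

Lemma sum_norm1_ball_le h (k n : nat) (c : R) : (k <= n)%N ->
  (forall x, (norm1 x <= k)%N -> h x <= c) ->
  \sum_(x <- norm1_ball D n | (norm1 x <= k)%N) h x <= (size (norm1_ball D k))%:R * c.
Proof.
move=> kn hc; rewrite -big_filter (perm_big (norm1_ball D k)); last first.
  apply: uniq_perm; rewrite ?filter_uniq ?fset_uniq// => x.
  rewrite mem_filter !in_norm1_ball andb_idr// => /leq_trans; exact.
have -> : (size (norm1_ball D k))%:R * c = \sum_(x <- norm1_ball D k) c.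
  by rewrite big_const_seq count_predT iter_addr addr0 mulr_natl.
rewrite big_seq [leRHS]big_seq; apply: ler_sum => x.
by rewrite in_norm1_ball; exact: hc.
Qed.

Lemma lap_supp f (M : R) x : (forall z, M < sqn z -> f z = 0) ->
  2 * M + 2 < sqn x -> 0 <= M -> lap f x = 0.
Proof.
move=> fM Mx M0; rewrite /lap big1// => i _.
have A := sqnD_le R (x + unit_vec i) (- unit_vec i).
have B := sqnD_le R (x - unit_vec i) (unit_vec i).
rewrite addrK sqnN sqn_unit_vec in A; rewrite subrK sqn_unit_vec in B.
by rewrite !fM; lra.
Qed.

Lemma harnack_even (s : nat) : (0 < s)%N -> D = (2 * s.+1)%N ->
  exists C : R, exists n0 : nat, 0 <= C /\ forall (n : nat) h, (n0 <= n)%N ->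
    (forall x, (norm1 x <= n)%N -> 0 <= h x) ->
    (forall x, (norm1 x <= n)%N -> lap h x = 0) ->
    forall y, (4 * D * norm1 y <= n)%N -> h y <= C * h 0.
Proof.
move=> s0 DE.
have far_nbr n a a' : (0 < n)%N -> ~~ (a <= n)%N -> (a <= a'.+1)%N ->
  (n < 2 * a')%N by lia.
have [Ca [c [Ca0 c0 upper]]] := @upper_kernel R D s s0 DE.
have [B [P0 [B0 P00 lower]]] := @lower_kernel R D s s0 DE.
have D0 : (0 < D)%N by rewrite DE.
have DR0 : 0 < D%:R :> R by rewrite ltr0n.
have DR1 : 1 <= D%:R :> R by rewrite ler1n.
(* 576 = 16 * 36 makes M = P / 16 admissible for [upper_kernel]. *)
pose P1 := P0 + 576.
(* Points with |x|^2 < B have graph norm at most D sqrt(B) <= D (B + 1). *)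
pose k0 := Num.bound (D%:R * (B + 1)).
pose n0 := (Num.bound (2 * D%:R * P1) + k0).+1%N.
(* Since M^(-s-1) = 16^(s+1) P^(-s-1), this weight makes lam Ca M^(-s-1) <= D P^(-s-1): the gain of
   [ub] pays for the loss of [ua]. The added 1 keeps the denominator positive. *)
pose lam : R := D%:R / (16 ^+ s.+1 * (Ca + 1)).
have e16 : 0 < 16 ^+ s.+1 :> R by rewrite exprn_gt0.
have lam0 : 0 < lam by rewrite divr_gt0// mulr_gt0//; lra.
pose E : R := (2 * D%:R) ^+ k0.
have E0 : 0 <= E by rewrite exprn_ge0// mulr_ge0.
pose C := E + 3 * D%:R * (size (norm1_ball D k0))%:R * E / (lam * c).
have C0 : E <= C.
  rewrite lerDl divr_ge0 ?(ltW (mulr_gt0 lam0 c0))//.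
  by rewrite mulr_ge0// mulr_ge0// mulr_ge0.
exists C, n0; split => [|n h n0n hge0 hharm y yn]; first exact: le_trans C0.
have h00 : 0 <= h 0 by apply: hge0; rewrite norm1_0.
have k0n : (k0 <= n)%N by apply: leq_trans n0n; rewrite leqW// leq_addl.
have near x : sqn x < B -> (norm1 x <= k0)%N.
  move=> xB; rewrite -(ler_nat R).
  apply: (@le_trans _ _ (D%:R * (B + 1))).
    apply: norm1_le_radius; first by lra.
    by apply: ltW; apply: lt_le_trans xB _; nra.
  by apply/ltW/archi_boundP; rewrite mulr_ge0//; lra.
have hchain x : (norm1 x <= k0)%N -> h x <= E * h 0.
  by move=> xk; apply: (harmonic_chain_le D0 hge0 hharm); rewrite xk.
have [yB|yB] := ltP (sqn y) B.
  by apply: le_trans (hchain _ (near _ yB)) _; rewrite ler_wpM2r.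
(* With this radius, |x|^2 <= P = rho^2 forces graph norm at most D rho = n / 2, so the support of
   [U] stays well inside the ball where [h] is harmonic. *)
pose rho : R := n%:R / (2 * D%:R).
have rhoP1 : P1 <= rho.
  rewrite ler_pdivlMr ?mulr_gt0// mulrC.
  apply: (@le_trans _ _ (Num.bound (2 * D%:R * P1))%:R).
    by apply/ltW/archi_boundP; rewrite !mulr_ge0// ?ltW// /P1; lra.
  by rewrite ler_nat; apply: leq_trans n0n; rewrite leqW// leq_addr.
pose P := rho ^+ 2; pose M := P / 16.
have rho1 : 1 <= rho by rewrite /P1 in rhoP1; lra.
have rho0 : 0 <= rho by lra.
have PP1 : P1 <= P.
  by apply: le_trans rhoP1 _; rewrite /P; nra.
have [|ub [ubN ub_ge ub_ge0 ub_geP]] := lower P; first by rewrite /P1 in PP1; lra.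
have [|ua [uaN ua_le]] := upper M; first by rewrite /M; rewrite /P1 in PP1; lra.
(* Then |x - y|^2 <= M = P / 16 gives |x|^2 <= 5P / 8, so the translate of [ua] is supported inside
   |x|^2 <= P. *)
have yP : sqn y <= P / 4.
  apply: le_trans (sqn_le_norm1 R y) _.
  have : (norm1 y)%:R <= rho / 2.
    rewrite -mulrA -invfM ler_pdivlMr ?mulr_gt0//.
    rewrite (_ : _ * _ = (4 * D * norm1 y)%:R) ?ler_nat//.
    by rewrite !natrM; ring.
  have : 0 <= (norm1 y)%:R :> R by [].
  by rewrite /P; nra.
have lamM : lam * (Ca * M ^- s.+1) <= D%:R * P ^- s.+1.
  have -> : M ^- s.+1 = 16 ^+ s.+1 * P ^- s.+1.
    by rewrite /M exprMn exprVn invfM invrK mulrC.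
  have P0' : 0 <= P ^- s.+1 by rewrite invr_ge0 exprn_ge0// sqr_ge0.
  rewrite !mulrA ler_wpM2r// /lam.
  rewrite (_ : _ * _ * _ = D%:R * (Ca / (Ca + 1))); last first.
    by field; rewrite !gt_eqF//; lra.
  by rewrite ler_piMr// ler_pdivrMr ?mul1r; lra.
have DP : D%:R * P ^- s.+1 <= D%:R.
  rewrite ler_piMr// invf_le1 ?exprn_gt0 ?exprn_ege1//; rewrite /P1 in PP1; lra.
pose U x := ub x - lam * ua (x - y).
have lapU x : lap U x = lap ub x - lam * lap ua (x - y).
  by rewrite lapB lap_shift.
(* 2D comes from [ub], and D from lam Ca M^(-s-1) <= D P^(-s-1) <= D. *)
have U_near x : - (3 * D%:R) <= lap U x.
  rewrite lapU; have := ub_ge x; have := ua_le (x - y).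
  move=> /(ler_wpM2l (ltW lam0)); rewrite mulrBr.
  have : 0 <= lam * (c * (x - y == 0)%:R).
    by apply: mulr_ge0; [exact: ltW|apply: mulr_ge0 => //; exact: ltW].
  by lra.
have U_far x : B <= sqn x -> lam * c * (x == y)%:R <= lap U x.
  move=> xB; rewrite lapU; have [xP|xP] := leP (sqn x) P.
    have := ub_geP x; rewrite xB xP => /(_ isT).
    have := ua_le (x - y) => /(ler_wpM2l (ltW lam0)); rewrite mulrBr subr_eq0.
    by lra.
  have -> : (x == y) = false by apply: contra_ltF xP => /eqP ->; rewrite /P1 in PP1; lra.
  rewrite mulr0 (lap_supp uaN) ?mulr0 ?subr0; last 2 first.
  - have := sqnD_le R (x - y) y; rewrite subrK /M; rewrite /P1 in PP1; lra.
  - by rewrite /M; rewrite /P1 in PP1; lra.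
  by rewrite ub_ge0.
have U_supp x : (n < 2 * norm1 x)%N -> U x = 0.
  move=> nx; have Px : P < sqn x.
    rewrite ltNge; apply: contraTN nx => /(norm1_le_radius rho0).
    rewrite -leqNgt -(ler_nat R) natrM /rho => A.
    rewrite -(@ler_pM2l _ 2)// in A.
    by apply: le_trans A _; rewrite le_eqVlt; apply/orP; left; apply/eqP; field; rewrite gt_eqF.
  rewrite /U ubN// uaN ?mulr0 ?subr0//.
  have := sqnD_le R (x - y) y; rewrite subrK /M; rewrite /P1 in PP1; lra.
have npos : (0 < n)%N by apply: leq_trans n0n.
have sum0 : \sum_(x <- norm1_ball D n) lap U x * h x = 0.
  rewrite sum_lap_by_parts.
  - by rewrite big_seq big1// => x; rewrite in_norm1_ball => /hharm ->; rewrite mulr0.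
  - move=> x; rewrite in_norm1_ball => /(far_nbr _ _ _ npos) nx.
    by apply: U_supp; apply: nx.
  - move=> x i; rewrite in_norm1_ball => /(far_nbr _ _ _ npos) nx.
    by apply: U_supp; apply: nx; exact: norm1D_unit_ge.
  - move=> x i; rewrite in_norm1_ball => /(far_nbr _ _ _ npos) nx.
    by apply: U_supp; apply: nx; exact: norm1B_unit_ge.
have yball : y \in norm1_ball D n.
  rewrite in_norm1_ball; apply: leq_trans yn.
  by rewrite leq_pmull// muln_gt0.
(* In the vanishing sum of [h] times Lap [U], the term at y is at least lam c h(y), and only the
   points with |x|^2 < B can contribute negatively. *)
have main : lam * c * h y <= 3 * D%:R * ((size (norm1_ball D k0))%:R * (E * h 0)).
  have hk0 : \sum_(x <- norm1_ball D n | (norm1 x <= k0)%N) h x <=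
      (size (norm1_ball D k0))%:R * (E * h 0) by apply: sum_norm1_ball_le.
  apply: le_trans (ler_wpM2l _ hk0); last by rewrite mulr_ge0// ltW.
  have -> : lam * c * h y = \sum_(x <- norm1_ball D n) lam * c * (x == y)%:R * h x.
    rewrite (big_rem y)//= eqxx mulr1 big1_seq ?addr0// => x /andP[_].
    by rewrite mem_rem_uniq ?fset_uniq// inE => /andP[/negPf -> _]; rewrite mulr0 mul0r.
  rewrite -subr_le0 mulr_sumr [in X in _ - X]big_mkcond -sumrB -[leRHS]sum0/=.
  rewrite big_seq [leRHS]big_seq; apply: ler_sum => x.
  rewrite in_norm1_ball => /hge0 hx.
  have [xB|xB] := ltP (sqn x) B.
    have -> : (x == y) = false by apply: contra_ltF xB => /eqP ->.
    rewrite near// mulr0 mul0r sub0r -mulNr.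
    exact: ler_wpM2r.
  apply: le_trans (ler_wpM2r hx (U_far _ xB)).
  by rewrite gerBl; case: ifP => // _; rewrite mulr_ge0// mulr_ge0// ltW.
rewrite /C mulrDl ler_wpDl ?mulr_ge0//.
have lc : 0 < lam * c by rewrite mulr_gt0.
rewrite [leRHS](_ : _ = 3 * D%:R * ((size (norm1_ball D k0))%:R * (E * h 0)) /
  (lam * c)); last by ring.
by rewrite ler_pdivlMr// mulrC.
Qed.

End Harnack.

(** * Functions constant in additional coordinates *)

Section Lift.
Variables (R : realType) (d m : nat).
Implicit Types (X : 'rV[int]_(d + m)) (h : 'rV[int]_d -> R).

Lemma norm1_lsubmx_le X : (norm1 (lsubmx X) <= norm1 X)%N.
Proof.
rewrite /norm1 big_split_ord/= (eq_bigr (fun i => `|X 0%R (lshift m i)|%N)).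
  exact: leq_addr.
by move=> i _; rewrite mxE.
Qed.

Lemma norm1_row_mx0 (y : 'rV[int]_d) : norm1 (row_mx y (0 : 'rV[int]_m)) = norm1 y.
Proof.
rewrite /norm1 big_split_ord/= [X in (_ + X)%N]big1 ?addn0 => [|i _].
  by apply: eq_bigr => i _; rewrite row_mxEl.
by rewrite row_mxEr mxE.
Qed.

Lemma lap_lsubmx h X : lap (fun Z => h (lsubmx Z)) X = lap h (lsubmx X).
Proof.
rewrite /lap big_split_ord/= [X in _ + X]big1 ?addr0 => [|i _].
  apply: eq_bigr => i _.
  have -> : unit_vec i = lsubmx (unit_vec (lshift m i)).
    by apply/rowP => j; rewrite !mxE (inj_eq (@lshift_inj _ _)).
  by rewrite -linearD -linearB.
have e0 : lsubmx (unit_vec (rshift d i)) = 0.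
  by apply/rowP => j; rewrite !mxE eq_lrshift andbF.
by rewrite linearD linearB /= e0 subr0 addr0; ring.
Qed.

End Lift.

(** * Arbitrary dimension and chains of balls *)

Section Chain.
Variables (R : realType) (d : nat).
Implicit Types (x y z : 'rV[int]_d) (h : 'rV[int]_d -> R).

(** Lift to dimension d + (d+2) = 2(d+1), that is s = d. Projection does not increase the graph
    norm, so the hypotheses on [h] carry over, and 4D becomes 8(d+1). *)
Lemma harnack_centered_large : (0 < d)%N -> exists C : R, exists n0 : nat,
  0 <= C /\ forall (n : nat) h, (n0 <= n)%N ->
    (forall x, (norm1 x <= n)%N -> 0 <= h x) ->
    (forall x, (norm1 x <= n)%N -> lap h x = 0) ->
    forall y, (8 * d.+1 * norm1 y <= n)%N -> h y <= C * h 0.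
Proof.
move=> d0; have DE : (d + d.+2 = 2 * d.+1)%N by lia.
have [C [n0 [C0 H]]] := @harnack_even R _ d d0 DE.
exists C, n0; split => // n h n0n hge0 hharm y yn.
have := H n (fun Z => h (lsubmx Z)) n0n _ _ (row_mx y 0).
rewrite row_mxKl linear0; apply.
- by move=> x xn; apply: hge0; exact: leq_trans (norm1_lsubmx_le _) xn.
- move=> x xn; rewrite lap_lsubmx; apply: hharm.
  exact: leq_trans (norm1_lsubmx_le _) xn.
- by rewrite norm1_row_mx0 DE mulnA.
Qed.

Lemma norm1D_le x y : (norm1 (x + y) <= norm1 x + norm1 y)%N.
Proof.
rewrite /norm1 -big_split/=; apply: leq_sum => i _; rewrite mxE.
by move: (x 0 i) (y 0 i) => a b; lia.
Qed.

Lemma norm1_unit (i : 'I_d) : norm1 (unit_vec i) = 1%N.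
Proof. by have := norm1D_unit 0 i; rewrite add0r norm1_0 mxE; lia. Qed.

(** Walk up to k unit steps from x towards 0; the truncated subtraction records that the walk stops
    at 0. *)
Lemma norm1_toward0 k x : exists y,
  (norm1 (x - y) <= k)%N /\ norm1 y = (norm1 x - k)%N.
Proof.
elim: k => [|k [y [xy yx]]]; first by exists x; rewrite subrr norm1_0 subn0.
have [kx|kx] := leqP (norm1 x) k.
  by exists y; split; [exact: leqW|rewrite yx; lia].
have [y' [y'k [i yE]]] := @norm1_step _ y (norm1 x - k.+1) ltac:(lia).
exists y'; split => //.
have -> : x - y' = (x - y) + (y - y') by rewrite addrA subrK.
apply: leq_trans (norm1D_le _ _) _; rewrite -[leqRHS]addn1 leq_add//.
by case: yE => ->; rewrite addrAC subrr add0r ?norm1N norm1_unit.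
Qed.

(** Hops of length at most k towards 0 stay in the ball, and the one-hop hypothesis is symmetric in
    its two points, so both inequalities follow. *)
Lemma harnack_chain (C : R) (n k : nat) h : 1 <= C ->
  (forall x, (norm1 x <= n)%N -> 0 <= h x) ->
  (forall x y, (norm1 x <= n)%N -> (norm1 y <= n)%N ->
     (norm1 (y - x) <= k)%N -> h y <= C * h x) ->
  forall j x, (norm1 x <= n)%N -> (norm1 x <= j * k)%N ->
    h x <= C ^+ j * h 0 /\ h 0 <= C ^+ j * h x.
Proof.
move=> C1 hge0 step; have C0 : 0 <= C by lra.
elim=> [|j IH] x xn xj.
  rewrite expr0 !mul1r (_ : x = 0)//; apply: norm1_eq0.
  by apply/eqP; rewrite -leqn0.
have [y [xy yx]] := norm1_toward0 k x.
have yn : (norm1 y <= n)%N by rewrite yx; lia.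
have [A B] := IH y yn ltac:(by rewrite yx leq_subLR -mulSn).
split.
  apply: le_trans (step _ _ yn xn xy) _.
  by rewrite exprS -[leRHS]mulrA ler_wpM2l.
apply: le_trans B _; rewrite exprSr -[leRHS]mulrA ler_wpM2l ?exprn_ge0//.
by apply: step => //; rewrite -opprB norm1N.
Qed.

Lemma harnack_centered : (0 < d)%N -> exists2 C : R, 1 <= C &
  forall (N n : nat) h, (2 * n <= N)%N ->
    (forall x, (norm1 x <= N.+1)%N -> 0 <= h x) ->
    (forall x, (norm1 x <= N)%N -> lap h x = 0) ->
    forall y z, (norm1 y <= n)%N -> (norm1 z <= n)%N -> h y <= C * h z.
Proof.
move=> d0; have [C0 [n0 [C00 H]]] := harnack_centered_large d0.
set c := (8 * d.+1)%N in H.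
have d1 : 1 <= d%:R :> R by rewrite ler1n.
pose C := C0 + 2 * d%:R; have C1 : 1 <= C by rewrite /C; lra.
(* K hops always suffice. If n < n0 + c, hops of length 1 are enough; otherwise hops have length n
   %/ c >= 1, and n < 2c (n %/ c). *)
pose K := (n0 + 2 * c)%N.
exists (C ^+ K * C ^+ K); first by rewrite -exprD exprn_ege1.
move=> N n h nN hge0 hharm.
have hn x : (norm1 x <= n)%N -> 0 <= h x by move=> xn; apply: hge0; lia.
have trans_norm x y : (norm1 x <= n)%N -> (norm1 y <= n)%N -> (norm1 (x + y) <= N)%N.
  by have := norm1D_le x y; lia.
have [k nk step] : exists2 k, (n <= K * k)%N & forall x y, (norm1 x <= n)%N ->
    (norm1 y <= n)%N -> (norm1 (y - x) <= k)%N -> h y <= C * h x.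
  have [nlt|nge] := ltnP n (n0 + c).
    exists 1%N => [|x y xn yn xy]; first by rewrite muln1 /K; lia.
    have hx := hn x xn.
    case: (posnP (norm1 (y - x))) => yx0.
      by rewrite (subr0_eq (norm1_eq0 yx0)) ler_peMl.
    have /norm1_step [z [/norm1_eq0 z0 [i yE]]] : norm1 (y - x) = 1%N by lia.
    have [|||A B] := @harmonic_nbr_le R d h x i (hharm _ _).
    - by lia.
    - by move=> j; apply: hge0; have := norm1D_le x (unit_vec j); rewrite norm1_unit; lia.
    - by move=> j; apply: hge0; have := norm1D_le x (- unit_vec j); rewrite norm1N norm1_unit; lia.
    apply: (@le_trans _ _ (2 * d%:R * h x)); last by rewrite ler_wpM2r// /C; lra.
    by rewrite -[y](subrK x) addrC; case: yE => ->; rewrite z0 add0r.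
  exists (n %/ c)%N.
    have := ltn_ceil n (isT : 0 < c)%N.
    have : (0 < n %/ c)%N by rewrite divn_gt0//; lia.
    rewrite /K; nia.
  move=> x y xn yn xy.
  (* The estimate is recentred at x: the ball of radius n about x lies in the ball of radius N
     because 2n <= N. *)
  have := H n (fun z => h (z + x)) _ _ _ (y - x); rewrite subrK add0r => Hx.
  apply: (@le_trans _ _ (C0 * h x)); last by rewrite ler_wpM2r ?hn// /C; lra.
  apply: Hx; first by lia.
  - by move=> z zn; apply: hge0; apply: leqW; exact: trans_norm.
  - move=> z zn; rewrite -[in LHS](opprK x) lap_shift opprK.
    by apply: hharm; exact: trans_norm.
  - by rewrite mulnC -leq_divRL.
have chain x : (norm1 x <= n)%N -> h x <= C ^+ K * h 0 /\ h 0 <= C ^+ K * h x.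
  move=> xn; apply: (harnack_chain C1 hn step) => //; exact: leq_trans nk.
move=> y z /chain[A _] /chain[_ B]; apply: le_trans A _.
by rewrite -mulrA ler_wpM2l// exprn_ge0//; lra.
Qed.

End Chain.

(** * Translation to the graph-distance formulation *)

Section Final.
Variables (R : realType) (d : nat).
Implicit Types (x y z : 'rV[int]_d) (h : 'rV[int]_d -> R).

Lemma graph_distE x y : graph_dist x y = norm1 (x - y).
Proof. by apply: eq_bigr => i _; rewrite !mxE. Qed.

Definition nbrs x : seq 'rV[int]_d :=
  [seq x + unit_vec i | i <- enum 'I_d] ++ [seq x - unit_vec i | i <- enum 'I_d].

Lemma nbrs_uniq x : uniq (nbrs x).
Proof.
have unit_inj : injective (@unit_vec d).
  move=> i j /rowP/(_ i)/eqP; rewrite !mxE !eqxx.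
  by case: (eqVneq i j).
have uD : uniq [seq x + unit_vec i | i <- enum 'I_d].
  by rewrite map_inj_uniq ?enum_uniq// => i j /addrI/unit_inj.
have uB : uniq [seq x - unit_vec i | i <- enum 'I_d].
  by rewrite map_inj_uniq ?enum_uniq// => i j /addrI/oppr_inj/unit_inj.
rewrite cat_uniq uD uB andbT/=.
apply/hasPn => _ /mapP[i _ ->]; apply/negP => /mapP[j _ /addrI/rowP/(_ i)].
by rewrite !mxE !eqxx/=; case: (i == j).
Qed.

Lemma adj_nbrs x : [set y | adj y x] = [set` nbrs x].
Proof.
apply/seteqP; split => y /=; rewrite /adj graph_distE mem_cat.
  move=> /norm1_step[z [/norm1_eq0 z0 [i yE]]].
  have {yE} : y = x + unit_vec i \/ y = x - unit_vec i.
    by case: yE; rewrite z0 add0r => <-; [left|right]; rewrite addrC subrK.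
  case=> ->; apply/orP; [left|right].
    by apply: (map_f (fun i => x + unit_vec i)); rewrite mem_enum.
  by apply: (map_f (fun i => x - unit_vec i)); rewrite mem_enum.
by case/orP => /mapP[i _ ->]; rewrite addrAC subrr add0r ?norm1N norm1_unit.
Qed.

(** d > 0 makes the factor (2d)^(-1) nonzero; the remaining neighbour sum is -Lap h(x). *)
Lemma laplacian_eq0 h x : (0 < d)%N -> laplacian h x = 0 -> lap h x = 0.
Proof.
move=> d0 /eqP; rewrite mulf_eq0 invr_eq0 mulf_eq0 !pnatr_eq0 (gtn_eqF d0)/=.
rewrite adj_nbrs -fsbig_seq ?nbrs_uniq//.
rewrite big_cat/= big_map big_enum [X in _ + X]big_map [X in _ + X]big_enum/= -big_split/= => /eqP S0.
apply: oppr_inj; rewrite oppr0 -[RHS]S0 /lap -sumrN.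
by apply: eq_bigr => i _; ring.
Qed.

Lemma argmax_seq (T : eqType) (f : T -> R) (a : T) (s : seq T) :
  exists2 x, x \in a :: s & forall y : T, y \in a :: s -> f y <= f x.
Proof.
elim: s a => [|b s IH] a; first by exists a; rewrite ?mem_head// => y /[!inE] /eqP ->.
have [x xs xmax] := IH b; have [ax|xa] := leP (f a) (f x).
  exists x => [|y]; first by rewrite inE xs orbT.
  by rewrite inE => /predU1P[->//|/xmax].
exists a => [|y]; first exact: mem_head.
by rewrite inE => /predU1P[->//|/xmax /le_trans -> //]; exact: ltW.
Qed.

Lemma argmax_norm1_ball (n : nat) h : exists2 x, (norm1 x <= n)%N &
  forall y, (norm1 y <= n)%N -> h y <= h x.
Proof.
have [x xs xmax] := argmax_seq h 0 (norm1_ball d n).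
exists x => [|y yn]; last by apply: xmax; rewrite inE in_norm1_ball yn orbT.
by move: xs; rewrite inE in_norm1_ball => /predU1P[->|//]; rewrite norm1_0.
Qed.

End Final.

Theorem theorem1p1 (R : realType) (d : nat) (hd : (1 <= d)%N) :
  exists2 C : R, 0 < C &
    forall (x0 : 'rV[int]_d) (r : R) (h : 'rV[int]_d -> R),
      1 <= r ->
      (forall x, lattice_closure (lattice_ball x0 r) x -> 0 <= h x) ->
      harmonic_in (lattice_ball x0 r) h ->
      exists M m : R,
        [/\ is_max (h @` lattice_ball x0 (r / 2)) M,
            is_min (h @` lattice_ball x0 (r / 2)) m
          & M <= C * m].
Proof.
have [C C1 H] := @harnack_centered R d hd.
exists C => [|x0 r h r1 hge0 hharm]; first by lra.
pose g z := h (z + x0).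
(* Graph distances are integers, so a ball of real radius is the ball of the truncated radius. *)
pose N := Num.truncn r; pose n := Num.truncn (r / 2).
have ballE (t : R) z : 0 <= t ->
    lattice_ball x0 t (z + x0) <-> (norm1 z <= Num.truncn t)%N.
  by move=> t0; rewrite /lattice_ball/= graph_distE addrK truncn_ge_nat.
have nN : (2 * n <= N)%N.
  rewrite truncn_ge_nat; last by lra.
  have : n%:R <= r / 2 by rewrite truncn_le; lra.
  by rewrite natrM; lra.
have gharm z : (norm1 z <= N)%N -> lap g z = 0.
  move=> zN; rewrite /g -[x0]opprK lap_shift opprK.
  by apply: laplacian_eq0 => //; apply: hharm; apply/ballE => //; lra.
(* Points of norm N + 1 lie on the boundary of the ball, where [h] is still nonnegative. *)
have gge0 z : (norm1 z <= N.+1)%N -> 0 <= g z.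
  rewrite leq_eqVlt ltnS => /predU1P[zN|zN]; apply: hge0; last first.
    by left; apply/ballE => //; lra.
  right; split; first by move=> /ballE; rewrite -/N zN ltnn => /(_ ltac:(lra)).
  have [z' [z'N [i zE]]] := norm1_step zN; exists (z' + x0).
    by apply/ballE; rewrite ?z'N//; lra.
  rewrite /adj graph_distE opprD addrACA subrr addr0.
  by case: zE => ->; rewrite opprD ?opprK addrA ?subrr ?add0r ?norm1N ?norm1_unit.
have [a an amax] := argmax_norm1_ball n g.
have [b bn bmin] := argmax_norm1_ball n (fun z => - g z).
have imE (P : R -> Prop) : (forall z, (norm1 z <= n)%N -> P (g z)) ->
    forall v, (h @` lattice_ball x0 (r / 2)) v -> P v.
  move=> Pg _ [z zb <-]; rewrite -[z](subrK x0); apply: Pg.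
  by apply/ballE; rewrite ?subrK//; lra.
exists (g a), (g b); split.
- split; first by exists (a + x0) => //; apply/ballE => //; lra.
  exact: (imE (fun v => v <= g a)).
- split; first by exists (b + x0) => //; apply/ballE => //; lra.
  by apply: (imE (fun v => g b <= v)) => z /bmin; rewrite lerN2.
- exact: (H N n).
Qed.
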